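(* Let $G$ be a deterministic automaton over a finite event set $E$ with uncontrollable events $E_{uc}\subseteq E$, let $d$ be a metric on $E$ with values in $[0,1]$, and let $\lambda\in[0,1]$. Let $K\subseteq L(G)$ be a language. Then $B(K,\lambda)^{\uparrow}$ is the supremal realization of $K^{\Uparrow}$.
   Context: Setting. $E$ is a finite set of events, partitioned as $E=E_c\sqcup E_{uc}$ (controllable / uncontrollable events); $E^*$ is the set of finite strings over $E$ including the empty string $\epsilon$; $l(s)$ is the length of a string $s$; $\overline{L}$ is the prefix closure of a language $L\subseteq E^*$. $G=(Q,E,\delta,q_0)$ is a deterministic automaton with partial transition function $\delta:Q\times E\to Q$, extended to strings as usual, and $L(G)=\{s\in E^*:\delta(q_0,s)\text{ is defined}\}$ (a prefix closed language containing $\epsilon$). Metrics. $d$ is a metric on $E$ with values in $[0,1]$. Set $d(\epsilon,\epsilon)=0$ and $d(a,\epsilon)=d(\epsilon,a)=1$ for $a\in E$. For strings $s=s_1\cdots s_{l(s)}$, $t=t_1\cdots t_{l(t)}$, pad the shorter one with $\epsilon$'s and define $d(s,t)=\sum_{i=1}^{\max\{l(s),l(t)\}}2^{-i}d(s_i,t_i)$. For a string $s$ and a language $A$, $d(s,A)=\inf_{a\in A}d(s,a)$ if $A\neq\emptyset$ and $d(s,\emptyset)=1$. For languages $A,B$, $d(A,B)$ is the Hausdorff metric: $d(\emptyset,\emptyset)=0$, and otherwise $d(A,B)=\max\{\sup_{a\in A}d(a,B),\sup_{b\in B}d(b,A)\}$ (a supremum over the empty set being $0$). Balls. For $s\in L(G)$,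 $B(s,\lambda)=\{t\in L(G):d(s,t)\le\lambda\}$, and for $K\subseteq L(G)$, $B(K,\lambda)=\bigcup_{s\in K}B(s,\lambda)$. Controllability. A language $K\subseteq L(G)$ is controllable if $\overline{K}E_{uc}\cap L(G)\subseteq\overline{K}$. $K^{\uparrow}$ denotes the supremal (largest) controllable sublanguage of $K$, i.e. the union of all controllable $M\subseteq K$. A language $K\subseteq L(G)$ is $\lambda$-controllable if there is a controllable language $\widetilde K\subseteq L(G)$ with $d(\widetilde K,K)\le\lambda$; such a $\widetilde K$ is called a realization of $K$. The supremal realization of a $\lambda$-controllable language is the union of all its realizations (which is itself a realization), i.e. its largest realization with respect to inclusion. $K^{\Uparrow}$ denotes the supremal $\lambda$-controllable sublanguage of $K$, i.e. the union of all $\lambda$-controllable languages $M\subseteq K$ (it is itself $\lambda$-controllable).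
   Formalization: The case where K is empty and λ = 1 is excluded: there L(G) is a realization of K^⇑ = ∅ because d(L(G),∅) = 1, so the supremal realization is L(G), which is nonempty, while B(∅,1)^↑ is empty. *)

(* Defs.v *)
From HB Require Import structures.
From mathcomp Require Import all_boot all_order all_algebra.
From mathcomp Require Import all_classical all_reals.

Set Implicit Arguments.
Unset Strict Implicit.
Unset Printing Implicit Defensive.

Import Order.TTheory GRing.Theory Num.Theory.
Local Open Scope classical_set_scope.
Local Open Scope ring_scope.

(** Strings over [E] are terms of type [seq E]; languages are classical sets
    of strings. The state set of an automaton may be infinite, and
    [delta q a = None] means that no transition is defined. *)
Record automaton (E : finType) := Automaton {
  state : Type;
  delta : state -> E -> option state;
  init_state : state
}.

Fixpoint run (E : finType) (G : automaton E) (q : state G) (s : seq E)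
    : option (state G) :=
  if s is a :: s' then
    if delta q a is Some q' then run q' s' else None
  else Some q.

Definition generated (E : finType) (G : automaton E) : set (seq E) :=
  [set s | isSome (run (init_state G) s)].

Definition prefix_closure (E : finType) (L : set (seq E)) : set (seq E) :=
  [set s | exists2 t, L t & prefix s t].

Record unit_metric (R : realType) (E : finType) (d : E -> E -> R) : Prop :=
  UnitMetric {
    um_ge0 : forall a b, 0 <= d a b;
    um_le1 : forall a b, d a b <= 1;
    um_eq0 : forall a b, d a b = 0 <-> a = b;
    um_sym : forall a b, d a b = d b a;
    um_triangle : forall a b c, d a c <= d a b + d b c
  }.

(** [None] plays the role of the padding symbol epsilon. *)
Definition event_dist (R : realType) (E : finType) (d : E -> E -> R)
    (x y : option E) : R :=
  match x, y with
  | None, None => 0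
  | Some a, Some b => d a b
  | _, _ => 1
  end.

(** Positions are numbered from 0 here, whence the exponent [i.+1]; [onth s i]
    is [None] as soon as [size s <= i], i.e., it reads [s] padded by epsilon. *)
Definition string_dist (R : realType) (E : finType) (d : E -> E -> R)
    (s t : seq E) : R :=
  \sum_(i < maxn (size s) (size t))
    2^-1 ^+ i.+1 * event_dist d (onth s i) (onth t i).

Definition dist_to_lang (R : realType) (E : finType) (d : E -> E -> R)
    (s : seq E) (A : set (seq E)) : R :=
  if A == set0 then 1 else inf [set string_dist d s a | a in A].

(** On [realType], [sup set0 = 0] (lemma [sup0]), so a supremum over an empty
    language is 0, and in particular [hausdorff d set0 set0 = 0]. All the
    suprema and infima below are over sets of reals in [0, 1]. *)
Definition hausdorff (R : realType) (E : finType) (d : E -> E -> R)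
    (A B : set (seq E)) : R :=
  Num.max (sup [set dist_to_lang d a B | a in A])
          (sup [set dist_to_lang d b A | b in B]).

Definition string_ball (R : realType) (E : finType) (G : automaton E)
    (d : E -> E -> R) (lambda : R) (s : seq E) : set (seq E) :=
  [set t | generated G t /\ string_dist d s t <= lambda].

Definition lang_ball (R : realType) (E : finType) (G : automaton E)
    (d : E -> E -> R) (lambda : R) (K : set (seq E)) : set (seq E) :=
  \bigcup_(s in K) string_ball G d lambda s.

Definition controllable (E : finType) (G : automaton E) (Euc : set E)
    (K : set (seq E)) : Prop :=
  K `<=` generated G /\
  [set rcons s e | s in prefix_closure K & e in Euc] `&` generated G
    `<=` prefix_closure K.

Definition sup_controllable (E : finType) (G : automaton E) (Euc : set E)
    (K : set (seq E)) : set (seq E) :=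
  \bigcup_(M in [set M | M `<=` K /\ controllable G Euc M]) M.

(** [realization G Euc d lambda K Kt]: [Kt] is a realization of [K]. *)
Definition realization (R : realType) (E : finType) (G : automaton E)
    (Euc : set E) (d : E -> E -> R) (lambda : R) (K Kt : set (seq E)) : Prop :=
  controllable G Euc Kt /\ hausdorff d Kt K <= lambda.

Definition lambda_controllable (R : realType) (E : finType) (G : automaton E)
    (Euc : set E) (d : E -> E -> R) (lambda : R) (K : set (seq E)) : Prop :=
  K `<=` generated G /\ exists Kt, realization G Euc d lambda K Kt.

Definition sup_lambda_controllable (R : realType) (E : finType)
    (G : automaton E) (Euc : set E) (d : E -> E -> R) (lambda : R)
    (K : set (seq E)) : set (seq E) :=
  \bigcup_(M in [set M | M `<=` K /\ lambda_controllable G Euc d lambda M]) M.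

(** [S] is the union of all realizations of [K], and is itself one of them. *)
Definition supremal_realization (R : realType) (E : finType)
    (G : automaton E) (Euc : set E) (d : E -> E -> R) (lambda : R)
    (K S : set (seq E)) : Prop :=
  realization G Euc d lambda K S /\
  S = \bigcup_(Kt in [set Kt | realization G Euc d lambda K Kt]) Kt.

(* Main.v *)
Require Import Defs.
From mathcomp Require Import all_boot all_order all_algebra.
From mathcomp Require Import all_classical all_reals.

Set Implicit Arguments.
Unset Strict Implicit.
Unset Printing Implicit Defensive.

Import Order.TTheory GRing.Theory Num.Theory.

Local Open Scope classical_set_scope.
Local Open Scope ring_scope.

(** Since [E] is finite, the distance from a string to a nonempty language is
    attained. Hence, as long as neither or both of [A] and [B] are empty,
    [hausdorff d A B <= lambda] says exactly that each of [A] and [B] lies in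
    the [lambda]-neighbourhood of the other. With this description, a
    controllable [M] inside [B(K, lambda)] realizes the set of all strings of
    [K] that are [lambda]-close to [M], and conversely every
    realization of a nonempty sublanguage of [K] is a controllable sublanguage
    of [B(K, lambda)]. *)

(** * Distances between strings and between languages *)

Section Distance.
Context {R : realType} {E : finType} {d : E -> E -> R}.
Hypothesis d_metric : unit_metric d.
Implicit Types (s t a b : seq E) (A B : set (seq E)) (lambda : R).

Lemma event_dist_ge0 x y : 0 <= event_dist d x y.
Proof. by case: x y => [x|] [y|] //=; exact: um_ge0. Qed.

Lemma event_dist_le1 x y : event_dist d x y <= 1.
Proof. by case: x y => [x|] [y|] //=; exact: um_le1. Qed.

Lemma event_dist_sym x y : event_dist d x y = event_dist d y x.
Proof. by case: x y => [x|] [y|] //=; exact: um_sym. Qed.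

Lemma string_dist_sym s t : string_dist d s t = string_dist d t s.
Proof.
rewrite /string_dist maxnC; apply: eq_bigr => i _.
by rewrite event_dist_sym.
Qed.

Lemma string_dist_ge0 s t : 0 <= string_dist d s t.
Proof.
apply: sumr_ge0 => i _.
by rewrite mulr_ge0 ?exprn_ge0 ?invr_ge0 ?event_dist_ge0.
Qed.

Lemma sum_half_powers N : \sum_(i < N) 2^-1 ^+ i.+1 = 1 - 2^-1 ^+ N :> R.
Proof.
elim: N => [|N IH]; first by rewrite big_ord0 expr0 subrr.
have -> : 1 - 2^-1 ^+ N.+1 = 1 - 2^-1 ^+ N + 2^-1 ^+ N.+1 :> R.
  by rewrite exprS mulrC [X in _ = _ - X + _]splitr opprD addrA addrNK.
by rewrite big_ord_recr /= IH.
Qed.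

Lemma string_dist_le1 s t : string_dist d s t <= 1.
Proof.
apply: (@le_trans _ _ (\sum_(i < maxn (size s) (size t)) 2^-1 ^+ i.+1)).
  apply: ler_sum => i _.
  by rewrite ler_piMr ?exprn_ge0 ?invr_ge0 ?event_dist_le1.
by rewrite sum_half_powers gerBl exprn_ge0 ?invr_ge0.
Qed.

(** Positions past both ends compare padding with padding and add 0, so distances for strings of
    different lengths become sums over one common range. *)
Lemma string_dist_widen N s t : (size s <= N)%N -> (size t <= N)%N ->
  string_dist d s t =
  \sum_(i < N) 2^-1 ^+ i.+1 * event_dist d (onth s i) (onth t i).
Proof.
move=> sN tN; have mN : (maxn (size s) (size t) <= N)%N by rewrite geq_max sN.
pose F i := 2^-1 ^+ i.+1 * event_dist d (onth s i) (onth t i).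
rewrite /string_dist (big_ord_widen N F mN) big_mkcond.
apply: eq_bigr => i _; case: ltnP => //.
by rewrite geq_max => /andP[si ti]; rewrite /F !onth_default // mulr0.
Qed.

(** Past the end of [s] every letter costs its full weight and padding costs nothing, so a shorter
    tail is at least as close. *)
Lemma string_dist_le_size s a b :
    (forall i, (i < size s)%N -> onth a i = onth b i) ->
  (size a <= size b)%N -> string_dist d s a <= string_dist d s b.
Proof.
move=> ab le_ab; pose N := (size s + size b)%N.
rewrite !(@string_dist_widen N) ?leq_addl ?leq_addr //; last first.
  exact: leq_trans le_ab (leq_addl _ _).
apply: ler_sum => i _; rewrite ler_wpM2l ?exprn_ge0 ?invr_ge0 //.
have [/ab-> //|si] := ltnP i (size s).
rewrite (onth_default si); have [ia|ia] := ltnP i (size a); last first.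
  by rewrite (onth_default ia) event_dist_ge0.
have : isSome (onth b i) by rewrite onthTE (leq_trans ia).
by case: (onth b i) => // y _; exact: event_dist_le1.
Qed.

(* Among the strings of [A] with given first [size s] letters a shortest one is
   closest to [s], so only finitely many candidates are left. *)
Lemma string_dist_attained s A : A !=set0 ->
  exists2 a, A a & forall b, A b -> string_dist d s a <= string_dist d s b.
Proof.
move=> [a0 Aa0].
(* Padding is recorded as [None], so strings shorter than [s] have keys too; finiteness of [E]
   leaves finitely many keys to minimise over. *)
pose key a : {ffun 'I_(size s) -> option E} :=
  [ffun i : 'I_(size s) => onth a i].
pose P w := `[< exists2 a, A a & key a = w >].
have /choice[g gP] : forall w, exists a, P w ->
    [/\ A a, key a = w & forall b, A b -> key b = w -> (size a <= size b)%N].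
  move=> w; have [/asboolP[a1 Aa1 ka1]|_] := boolP (P w); last by exists [::].
  have ex_size : exists n, `[< exists a, [/\ A a, key a = w & size a = n] >].
    by exists (size a1); apply/asboolP; exists a1.
  case: (ex_minnP ex_size) => _ /asboolP[a [Aa ka <-]] amin.
  exists a => _; split=> // b Ab kb.
  by apply: amin; apply/asboolP; exists b.
have Pkey b : A b -> P (key b) by move=> Ab; apply/asboolP; exists b.
case: (arg_minP (fun w => string_dist d s (g w)) (Pkey _ Aa0)) => w Pw wmin.
have [Agw _ _] := gP _ Pw; exists (g w) => // b Ab.
have Pb := Pkey _ Ab; apply: le_trans (wmin _ Pb) _.
have [_ kg gmin] := gP _ Pb; apply: string_dist_le_size; last exact: gmin.
move=> i si; move/ffunP: kg => /(_ (Ordinal si)).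
by rewrite !ffunE.
Qed.

Lemma string_dist_has_lbound s A : has_lbound [set string_dist d s a | a in A].
Proof. by exists 0 => _ [a _ <-]; exact: string_dist_ge0. Qed.

Lemma dist_to_lang_le lambda s A a :
  A a -> string_dist d s a <= lambda -> dist_to_lang d s A <= lambda.
Proof.
move=> Aa sa; rewrite /dist_to_lang ifF; last first.
  by apply/negbTE/set0P; exists a.
apply: le_trans sa; apply: ge_inf; first exact: string_dist_has_lbound.
by exists a.
Qed.

Lemma dist_to_lang_le1 s A : dist_to_lang d s A <= 1.
Proof.
have [->|/set0P[a Aa]] := eqVneq A set0; first by rewrite /dist_to_lang eqxx.
exact: dist_to_lang_le Aa (string_dist_le1 _ _).
Qed.

(** The infimum is a minimum, so the bound is met by an actual string without any slack. *)
Lemma dist_to_lang_leP lambda s A : A !=set0 -> dist_to_lang d s A <= lambda ->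
  exists2 a, A a & string_dist d s a <= lambda.
Proof.
move=> A0; have [a Aa amin] := string_dist_attained s A0.
rewrite /dist_to_lang ifF; last by apply/negbTE/set0P.
move=> infA; exists a => //; apply: le_trans infA.
by apply: lb_le_inf => [|_ [b Ab <-]]; [exists (string_dist d s a), a|exact: amin].
Qed.

Lemma hausdorff_sym A B : hausdorff d A B = hausdorff d B A.
Proof. exact: maxC. Qed.

Lemma dist_to_lang_le_hausdorff A B a :
  A a -> dist_to_lang d a B <= hausdorff d A B.
Proof.
move=> Aa; rewrite /hausdorff le_max; apply/orP; left.
apply: ub_le_sup; last by exists a.
by exists 1 => _ [x _ <-]; exact: dist_to_lang_le1.
Qed.

Lemma hausdorff_close lambda A B a : hausdorff d A B <= lambda -> A a ->
  B !=set0 -> exists2 b, B b & string_dist d a b <= lambda.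
Proof.
move=> AB Aa B0; apply: dist_to_lang_leP => //.
exact: le_trans (dist_to_lang_le_hausdorff _ Aa) AB.
Qed.

(** The distance from a string to the empty language is 1 by convention, which exceeds [lambda]. *)
Lemma hausdorff_neq0 lambda A B :
  lambda < 1 -> hausdorff d A B <= lambda -> A !=set0 -> B !=set0.
Proof.
move=> lt1 AB [a Aa]; apply/set0P/negP => /eqP B0.
have := le_trans (dist_to_lang_le_hausdorff B Aa) AB.
by rewrite /dist_to_lang B0 eqxx leNgt lt1.
Qed.

Lemma hausdorff_le lambda A B : 0 <= lambda ->
    (forall a, A a -> exists2 b, B b & string_dist d a b <= lambda) ->
    (forall b, B b -> exists2 a, A a & string_dist d b a <= lambda) ->
  hausdorff d A B <= lambda.
Proof.
move=> l0.
have bound C D :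
    (forall c, C c -> exists2 e, D e & string_dist d c e <= lambda) ->
    sup [set dist_to_lang d c D | c in C] <= lambda.
  (* For empty [C] the supremum is 0 by convention, and [0 <= lambda] settles it. *)
  move=> CD; have [->|/set0P[c Cc]] := eqVneq C set0.
    by rewrite image_set0 sup0.
  apply: ge_sup => [|_ [x /CD[e De xe] <-]].
    by exists (dist_to_lang d c D), c.
  exact: dist_to_lang_le De xe.
by move=> AB BA; rewrite /hausdorff ge_max !bound.
Qed.

End Distance.

(** * Controllable languages and their unions *)

Section Controllability.
Context {E : finType} {G : automaton E} {Euc : set E}.

Lemma prefix_closure_sub (A B : set (seq E)) :
  A `<=` B -> prefix_closure A `<=` prefix_closure B.
Proof. by move=> AB s [t /AB Bt st]; exists t. Qed.

(** A prefix of a string of the union is a prefix of a string of one member, whose controllability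
    supplies the extension. *)
Lemma controllable_bigcup (F : set (set (seq E))) :
  (forall M, F M -> controllable G Euc M) ->
  controllable G Euc (\bigcup_(M in F) M).
Proof.
move=> FC; split=> [s [M FM Ms]|u [[s [t [M FM Mt] st] [e eE <-]] Gu]].
  by have [+ _] := FC _ FM; apply.
have MU : M `<=` \bigcup_(N in F) N by move=> x Mx; exists M.
apply: (prefix_closure_sub MU); have [_] := FC _ FM; apply; split=> //.
by exists s; [exists t|exists e].
Qed.

Lemma controllable_generated : controllable G Euc (generated G).
Proof.
by split=> // u [_ Gu]; exists u => //; exact: prefix_refl.
Qed.

Lemma sup_controllable_controllable K :
  controllable G Euc (sup_controllable G Euc K).
Proof. by apply: controllable_bigcup => M []. Qed.

End Controllability.

(** * Realizations and neighbourhoods *)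

Section LambdaControllability.
Context {R : realType} {E : finType} {G : automaton E} {Euc : set E}.
Context {d : E -> E -> R} {lambda : R}.
Hypotheses (d_metric : unit_metric d).
Hypotheses (lambda_ge0 : 0 <= lambda) (lambda_le1 : lambda <= 1).
Implicit Types (K M Kt : set (seq E)).

Lemma lambda_controllable_neighbourhood K M :
    K `<=` generated G -> controllable G Euc M -> M `<=` lang_ball G d lambda K ->
  lambda_controllable G Euc d lambda
    [set k | K k /\ exists2 m, M m & string_dist d k m <= lambda].
Proof.
move=> KG MC MK; split=> [k [/KG]//|]; exists M; split=> //.
apply: hausdorff_le => // [m Mm|k [_ //]].
have [k Kk [_ km]] := MK _ Mm.
by exists k; [split=> //; exists m|rewrite string_dist_sym].
Qed.

Lemma realization_sub_lang_ball K Kt : realization G Euc d lambda K Kt ->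
  K !=set0 -> Kt `<=` lang_ball G d lambda K.
Proof.
move=> [[KtG _] KtK] K0 s Kts.
have [k Kk sk] := hausdorff_close d_metric KtK Kts K0.
by exists k => //; split; [exact: KtG|rewrite string_dist_sym].
Qed.

(** All string distances are at most 1, so any two nonempty languages are within Hausdorff distance
    1. *)
Lemma lambda1_realization K Kt : lambda = 1 -> controllable G Euc Kt ->
  K !=set0 -> Kt !=set0 -> realization G Euc d lambda K Kt.
Proof.
move=> l1 KtC [k Kk] [s Kts]; split=> //; rewrite l1.
by apply: hausdorff_le => // ? _; [exists k|exists s]; rewrite ?string_dist_le1.
Qed.

(* For [lambda = 1] the given realization may be empty. *)
Lemma lambda_controllable_realization_neq0 K :
    lambda_controllable G Euc d lambda K -> K !=set0 ->
  exists2 Kt, realization G Euc d lambda K Kt & Kt !=set0.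
Proof.
move=> [KG [Kt KtK]] K0; have [l1|nl1] := eqVneq lambda 1.
  have G0 : generated G !=set0 by exists [::].
  by exists (generated G) => //; apply: lambda1_realization => //;
    exact: controllable_generated.
exists Kt => //; have [_ KtK'] := KtK; move: KtK'; rewrite hausdorff_sym => KtK'.
by apply: (hausdorff_neq0 d_metric _ KtK') => //; rewrite lt_neqAle nl1.
Qed.

Lemma lang_ball_sub K M :
  K `<=` M -> lang_ball G d lambda K `<=` lang_ball G d lambda M.
Proof. by move=> KM; apply: bigcup_subset. Qed.

Lemma sup_lambda_controllable_sub K :
  sup_lambda_controllable G Euc d lambda K `<=` K.
Proof. by move=> s [M [MK _] Ms]; exact: MK. Qed.

Lemma sup_controllable_lang_ball_realization K : K `<=` generated G ->
  realization G Euc d lambda (sup_lambda_controllable G Euc d lambda K)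
    (sup_controllable G Euc (lang_ball G d lambda K)).
Proof.
move=> KG; split; first exact: sup_controllable_controllable.
apply: hausdorff_le => // [s [M [MK MC] Ms]|k [M [MK MC] Mk]].
  (* The centre [k] of a ball containing [s] lies in the set of strings of [K] close to [M], a
     [lambda]-controllable sublanguage of [K]. *)
  have [k Kk [_ ks]] := MK _ Ms; exists k; last by rewrite string_dist_sym.
  exists [set k | K k /\ exists2 m, M m & string_dist d k m <= lambda].
    by split=> [? []//|]; exact: lambda_controllable_neighbourhood.
  by split=> //; exists s.
(* Conversely, [k] is close to a nonempty realization of [M], which is a controllable sublanguage of
   the ball around [K]. *)
have M0 : M !=set0 by exists k.
have [Kt KtM Kt0] := lambda_controllable_realization_neq0 MC M0.
have [KtC] := KtM; rewrite hausdorff_sym => MKt.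
have [s Kts ks] := hausdorff_close d_metric MKt Mk Kt0.
exists s => //; exists Kt => //; split=> //.
apply: subset_trans (lang_ball_sub MK).
exact: realization_sub_lang_ball.
Qed.

(** Here [K] itself is [lambda]-controllable, realized by [generated G]. *)
Lemma sup_lambda_controllable_neq0 K : lambda = 1 -> K `<=` generated G ->
  K !=set0 -> sup_lambda_controllable G Euc d lambda K !=set0.
Proof.
move=> l1 KG K0; have [k Kk] := K0; exists k, K => //; split=> //; split=> //.
have G0 : generated G !=set0 by exists [::].
exists (generated G); apply: lambda1_realization => //.
exact: controllable_generated.
Qed.

End LambdaControllability.

Theorem theorem3 (R : realType) (E : finType) (G : automaton E) (Euc : set E)
    (d : E -> E -> R) (lambda : R) (K : set (seq E))
    (d_metric : unit_metric d)
    (lambda_ge0 : 0 <= lambda) (lambda_le1 : lambda <= 1)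
    (K_sub : K `<=` generated G)
    (nondegenerate : K = set0 -> lambda < 1) :
  supremal_realization G Euc d lambda
    (sup_lambda_controllable G Euc d lambda K)
    (sup_controllable G Euc (lang_ball G d lambda K)).
Proof.
have real := sup_controllable_lang_ball_realization
  (Euc := Euc) d_metric lambda_ge0 lambda_le1 K_sub.
split=> //; apply/seteqP; split=> [s Ss|s [Kt KtN Kts]].
  by eexists; [exact: real|].
have [KtC KtN'] := KtN; exists Kt => //; split=> //.
have NK := @sup_lambda_controllable_sub R E G Euc d lambda K.
apply: subset_trans (lang_ball_sub NK).
apply: realization_sub_lang_ball KtN _ => //.
(* For [lambda < 1], nonemptiness passes from [Kt] to the language it realizes. *)
have [l1|nl1] := eqVneq lambda 1; last first.
  by apply: (hausdorff_neq0 d_metric _ KtN'); [rewrite lt_neqAle nl1|exists s].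
apply: sup_lambda_controllable_neq0 => //.
(* If [K] were empty with [lambda = 1], every controllable language would be a realization, while
   the ball around [K] is empty; [nondegenerate] excludes this. *)
by apply/set0P/negP => /eqP /nondegenerate; rewrite l1 ltxx.
Qed.
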